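(* Let $a\in\mathbb{N}^n$ be nonincreasing such that $\sum_{i\le n}a_i=\binom{n}{2}$. For $k\in\{1,\dots,n\}$ let $(\mathrm{L}_k)$ denote the inequality $$\sum_{i\le k}a_i\le\binom{n}{2}-\binom{n-k}{2}.$$ The following are equivalent: (1) $a$ is a score sequence; (2) $a\trianglelefteq b^L$, where $b^L\in\mathbb{N}^n$ is given by $b^L_k=n-k$; (3) $(\mathrm{L}_k)$ holds for all $k\in\{1,\dots,n\}$; (4) $(\mathrm{L}_k)$ holds for all $k\in C(a)$; (5) $(\mathrm{L}_k)$ holds for all $k\in\{1,\dots,n-1\}$ such that $a_k>n-k>a_{k+1}$; (6) $j\,a'_j+\sum_{i>j}a'_i\le\binom{n}{2}-\binom{n-a'_j}{2}$ for all $j\in C(a')$.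
   Context: $\mathbb{N}=\{0,1,2,\dots\}$. A tournament is a simple directed graph such that for each pair of distinct vertices $v_1,v_2$ exactly one of the edges $(v_1,v_2)$, $(v_2,v_1)$ is present. $a\in\mathbb{N}^n$ is a score sequence if it is the (out-)degree sequence of a tournament on $n$ vertices. The conjugate $a'=(a'_1,a'_2,\dots)$ is $a'_k=\#\{i:a_i\ge k\}$. For $x,y\in\mathbb{N}^n$, $x\trianglelefteq y$ means $\sum_{i\le k}x_i\le\sum_{i\le k}y_i$ for all $k\in\{1,\dots,n\}$. The set of corners is $C(a)=\{k:1\le k\le n,\ a_k>a_{k+1}\}$ with the convention $a_{n+1}=0$; likewise $C(a')=\{j\ge1:a'_j>a'_{j+1}\}$. *)

(* Defs.v *)
From mathcomp Require Import all_boot.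

Set Implicit Arguments.
Unset Strict Implicit.
Unset Printing Implicit Defensive.

(* Vectors of N^n are n-tuples with entries numbered from 1; for k > n the
   default value of nth gives entry x k = 0, hence the convention a_(n+1) = 0.
   entry x 0 is a junk value that is never used. *)
Definition entry n (x : n.-tuple nat) (k : nat) : nat := nth 0 x k.-1.

Definition psum n (x : n.-tuple nat) (k : nat) : nat :=
  \sum_(1 <= i < k.+1) entry x i.

Definition tournament (V : finType) (e : rel V) : Prop :=
  irreflexive e /\ (forall u v : V, u != v -> e u v (+) e v u).

Definition outdeg (V : finType) (e : rel V) (v : V) : nat := #|[set w | e v w]|.

Definition score_sequence n (a : n.-tuple nat) : Prop :=
  exists e : rel 'I_n,
    tournament e /\ (forall i : 'I_n, tnth a i = outdeg e i).

Definition conjugate n (a : n.-tuple nat) (k : nat) : nat :=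
  #|[set i : 'I_n | k <= tnth a i]|.

(* No equality of the total sums is required. *)
Definition dominated n (x y : n.-tuple nat) : Prop :=
  forall k : nat, 1 <= k <= n -> psum x k <= psum y k.

Definition corners n (a : n.-tuple nat) : {pred nat} :=
  [pred k | (1 <= k <= n) && (entry a k.+1 < entry a k)].

Definition conjugate_corners n (a : n.-tuple nat) : {pred nat} :=
  [pred j | (1 <= j) && (conjugate a j.+1 < conjugate a j)].

Definition landau_vector n : n.-tuple nat := [tuple n - i.+1 | i < n].

Definition landau_ineq n (a : n.-tuple nat) (k : nat) : bool :=
  psum a k <= 'C(n, 2) - 'C(n - k, 2).

(* The sum of a'_i over all i > j, truncated at the largest entry of a:
   see conjugate_eq0. *)
Definition conjugate_tail n (a : n.-tuple nat) (j : nat) : nat :=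
  \sum_(j.+1 <= i < (\max_(l < n) tnth a l).+1) conjugate a i.

Lemma conjugate_eq0 n (a : n.-tuple nat) (i : nat) :
  \max_(l < n) tnth a l < i -> conjugate a i = 0.
Proof.
move=> lt_max_i; apply/eqP; rewrite cards_eq0; apply/eqP/setP => l.
rewrite !inE leqNgt; apply/negbTE; rewrite negbK.
exact: leq_ltn_trans (leq_bigmax l) lt_max_i.
Qed.

(* Main.v *)
(** If some vertex [u] of a tournament has too large an outdegree, let [S] be
    the set of vertices reachable from [u].  The outdegrees over [S] sum to
    ['C(#|S|, 2)], so Landau's inequality for the complement of [S] provides a
    vertex [v] of [S] whose outdegree is too small, and reversing a path from
    [u] to [v] moves one unit of score from [u] to [v].  For (5) => (3), the
    first maximiser [k] of the excess [psum a k - psum (landau_vector n) k]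
    satisfies [a_k > n - k > a_(k+1)].  For (6), [psum a k] equals
    [k * t + \sum_i (a_i - t)] for each threshold [t] between [a_k] and
    [a_(k+1)]. *)
Require Import Defs.
From mathcomp Require Import all_boot.
From mathcomp Require Import zify.

Set Implicit Arguments.
Unset Strict Implicit.
Unset Printing Implicit Defensive.

(** * Outdegree sums over sets of vertices *)

Section Tournaments.

Variable V : finType.
Implicit Types (e : rel V) (S : {set V}).

Lemma outdegE e v : outdeg e v = \sum_w e v w.
Proof.
rewrite /outdeg -sum1dep_card big_mkcond.
by apply: eq_bigr => w _; case: (e v w).
Qed.

Lemma sum_andb_eq (b : bool) (v : V) : \sum_w (b && (w == v)) = b :> nat.
Proof.
rewrite (bigD1 v) //= eqxx andbT big1 ?addn0 // => w /negbTE ->.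
by rewrite andbF.
Qed.

Lemma tournament_antisym e u v : tournament e -> e u v -> e v u = false.
Proof.
case=> e_irr e_tot euv; have uv : u != v.
  by apply/eqP => uv; rewrite uv e_irr in euv.
by have := e_tot u v uv; rewrite euv; case: (e v u).
Qed.

(** Added to its transpose, the double sum counts each ordered pair of distinct vertices of [S]
    once, hence [#|S| * #|S|.-1]. *)
Lemma sum_outdeg_induced e S : tournament e ->
  \sum_(v in S) \sum_(w in S) e v w = 'C(#|S|, 2).
Proof.
case=> e_irr e_tot; rewrite bin2 -[LHS]doubleK -addnn; congr _./2.
rewrite {2}exchange_big /= -big_split /= -sum_nat_const.
apply: eq_bigr => v vS; rewrite -big_split /= (bigD1 v) //= e_irr add0n.
rewrite (cardsD1 v S) vS add1n /= -sum1_card.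
apply: eq_big => [w|w /andP[_ wv]]; first by rewrite !inE andbC.
by have := e_tot _ _ wv; case: (e v w); case: (e w v).
Qed.

Lemma leq_sum_outdeg e S : tournament e ->
  'C(#|S|, 2) <= \sum_(v in S) outdeg e v.
Proof.
move=> e_tour; rewrite -(sum_outdeg_induced S e_tour).
apply: leq_sum => v _; rewrite outdegE [leqRHS](bigID (mem S)) /=.
exact: leq_addr.
Qed.

Lemma sum_outdeg_closed e S : tournament e ->
  (forall v w, v \in S -> e v w -> w \in S) ->
  \sum_(v in S) outdeg e v = 'C(#|S|, 2).
Proof.
move=> e_tour Scl; rewrite -(sum_outdeg_induced S e_tour).
apply: eq_bigr => v vS; rewrite outdegE (bigID (mem S)) /=.
rewrite [X in _ + X]big1 ?addn0 // => w wS.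
by apply/eqP; rewrite eqb0; apply: contra wS; apply: Scl.
Qed.

Lemma sum_outdeg e : tournament e -> \sum_v outdeg e v = 'C(#|V|, 2).
Proof.
move=> e_tour; rewrite -cardsT -(sum_outdeg_closed e_tour) => [|v w]; rewrite ?inE //.
by apply: eq_bigl => v; rewrite inE.
Qed.

(** * Reversal of edges and paths *)

Definition reverse_edge e u v : rel V := fun x y =>
  if (x == u) && (y == v) then false
  else if (x == v) && (y == u) then true else e x y.

Lemma tournament_reverse_edge e u v :
  tournament e -> u != v -> tournament (reverse_edge e u v).
Proof.
move=> [e_irr e_tot] uv; split=> [x|x y xy]; rewrite /reverse_edge.
  by rewrite [(x == v) && _]andbC; case: eqP => [->|]; rewrite //= (negbTE uv).
have := e_tot x y xy; rewrite [(y == u) && _]andbC [(y == v) && _]andbC.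
case: (x =P u) => [->|xu]; case: (y =P v) => [->|yv] /=.
- by rewrite [v == u]eq_sym (negbTE uv).
- by case: (u =P v) (uv) => //=.
- by case: (x =P v) => //= ->; case: (v =P u) uv => // ->; rewrite eqxx.
- by case: (x =P v) => //= _; case: (y =P u).
Qed.

(** Once both indicator terms are written as sums over [y], supported at [v] and [u], the identity
    holds edge by edge. The additive form avoids truncated subtraction. *)
Lemma outdeg_reverse_edge e u v w : tournament e -> e u v ->
  outdeg (reverse_edge e u v) w + (w == u) = outdeg e w + (w == v).
Proof.
move=> e_tour euv; have evu := tournament_antisym e_tour euv.
rewrite !outdegE -(sum_andb_eq (w == u) v) -(sum_andb_eq (w == v) u).
rewrite -!big_split; apply: eq_bigr => y _ /=; rewrite /reverse_edge.
case: andP => [[/eqP-> /eqP->]|_].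
  case: andP => [[/eqP uv _]|_]; last by rewrite euv.
  by move: euv evu; rewrite uv => ->.
by case: andP => [[/eqP-> /eqP->]|_]; rewrite ?evu // addn0.
Qed.

(* The last clause lets the induction flip the edge entering the head of an
   already reversed path. *)
Lemma tournament_reverse_path e u p :
  tournament e -> path e u p -> uniq (u :: p) ->
  exists e', [/\ tournament e',
    forall w, outdeg e' w + (w == u) = outdeg e w + (w == last u p) &
    forall x y, x \notin u :: p -> e' x y = e x y].
Proof.
move=> e_tour; elim: p u => [|v p IHp] u /=; first by exists e.
case/andP=> euv vp /andP[uvp vp_uniq].
have [e' [e'_tour deg_e' e'_out]] := IHp v vp vp_uniq.
have e'uv : e' u v by rewrite e'_out.
have uv : u != v by apply: contraNneq uvp => ->; rewrite mem_head.
exists (reverse_edge e' u v); split=> [|w|x y].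
- exact: tournament_reverse_edge.
- by have := outdeg_reverse_edge w e'_tour e'uv; have := deg_e' w; lia.
- rewrite inE negb_or => /andP[/negbTE xu xvp]; rewrite /reverse_edge xu /=.
  have xv : x != v by apply: contraNneq xvp => ->; rewrite mem_head.
  rewrite (negbTE xv) /=.
  exact: e'_out.
Qed.

Lemma tournament_transfer e u v : tournament e -> connect e u v ->
  exists e', tournament e' /\
    forall w, outdeg e' w + (w == u) = outdeg e w + (w == v).
Proof.
move=> e_tour /connectP[p up ->]; case/shortenP: up => q uq q_uniq _.
by have [e' []] := tournament_reverse_path e_tour uq q_uniq; exists e'.
Qed.

(** * Tournaments with prescribed scores *)

Lemma tournament_exists : exists e, tournament e.
Proof.
exists (fun u v => enum_rank u < enum_rank v); split=> [v|u v uv].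
  exact: ltnn.
rewrite -(inj_eq enum_rank_inj) -(inj_eq val_inj) /= in uv.
by case: ltngtP uv.
Qed.

Lemma landau_tournament (a : V -> nat) :
  (forall S, 'C(#|S|, 2) <= \sum_(v in S) a v) ->
  \sum_v a v = 'C(#|V|, 2) ->
  exists e, tournament e /\ forall v, a v = outdeg e v.
Proof.
move=> landau_a sum_a; have [e e_tour] := tournament_exists.
(* Induction on the total excess; truncated subtraction makes only vertices of too large outdegree
   count. *)
have [m] := ubnP (\sum_v (outdeg e v - a v)).
elim: m e e_tour => // m IHm e e_tour lt_m.
have [/forallP le_a|] := boolP [forall v, outdeg e v <= a v].
  exists e; split=> // v; apply/eqP; rewrite eq_sym eqn_leq le_a /= leqNgt.
  apply/negP => lt_v; have := sum_outdeg e_tour; rewrite -sum_a.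
  rewrite (bigD1 v) // [in RHS](bigD1 v) //=.
  have : \sum_(w | w != v) outdeg e w <= \sum_(w | w != v) a w.
    by apply: leq_sum => w _.
  lia.
case/forallPn=> u; rewrite -ltnNge => gt_u.
(* A transfer from [u] to a deficient [v] lowers the excess at [u], while that of [v] stays 0. *)
have [|/existsPn noS] := boolP [exists v, connect e u v && (outdeg e v < a v)].
  case/existsP=> v /andP[uv lt_v].
  have [e' [e'_tour deg_e']] := tournament_transfer e_tour uv.
  apply: (IHm e') => //; apply: (leq_trans _ (ltnSE lt_m)).
  rewrite (bigD1 u) // [leqRHS](bigD1 u) //= -addSn leq_add //.
    have := deg_e' u; rewrite eqxx.
    by case: eqP => [uv_eq|_]; [move: lt_v gt_u; rewrite uv_eq|]; lia.
  apply: leq_sum => w wu; have := deg_e' w; rewrite (negbTE wu).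
  by case: eqP => [->|_]; lia.
(* No vertex of [S] is deficient and [u] is in excess, so [a] sums over [S] to less than
   ['C(#|S|, 2)], a contradiction. *)
pose S := [set v | connect e u v].
have uS : u \in S by rewrite inE connect0.
have := sum_outdeg_closed (S := S) e_tour; have := landau_a S.
rewrite (bigD1 u) //= [\sum_(v in S) outdeg e v](bigD1 u) //=.
have le_S : \sum_(w in S | w != u) a w <= \sum_(w in S | w != u) outdeg e w.
  apply: leq_sum => w /andP[]; rewrite inE => uw _.
  by have := noS w; rewrite uw /= -leqNgt.
move=> le_C deg_S; have {}deg_S := deg_S _; move: le_C; rewrite -deg_S; first lia.
by move=> v w; rewrite !inE => uv vw; apply: connect_trans uv (connect1 vw).
Qed.

End Tournaments.

(** * Partial sums of vectors *)

Section Vectors.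

Variables (n : nat).
Implicit Types (a : n.-tuple nat).

Lemma entry_tnth a (i : 'I_n) : entry a i.+1 = tnth a i.
Proof. by rewrite (tnth_nth 0). Qed.

Lemma entry_sorted a k l : sorted geq a -> 0 < k <= l -> entry a l <= entry a k.
Proof.
move=> a_sorted /andP[k0 kl]; rewrite /entry.
have [l_big|l_small] := leqP n l.-1; first by rewrite nth_default ?size_tuple.
have geq_trans : transitive geq by move=> x y z /= xy yz; apply: leq_trans yz xy.
apply: (sorted_leq_nth geq_trans leqnn 0 a_sorted); rewrite ?inE ?size_tuple; lia.
Qed.

Lemma psumS a k : psum a k.+1 = psum a k + entry a k.+1.
Proof. by rewrite /psum big_nat_recr. Qed.

Lemma psum0 a : psum a 0 = 0.
Proof. by rewrite /psum big_geq. Qed.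

Lemma psum_tnth a k : k <= n -> psum a k = \sum_(i < n | i < k) tnth a i.
Proof.
move=> kn; rewrite /psum big_add1 /= big_mkord.
rewrite (big_ord_widen n (fun i => entry a i.+1)) //.
by apply: eq_bigr => i _; rewrite entry_tnth.
Qed.

Lemma psum_all a : psum a n = \sum_(i < n) tnth a i.
Proof. by rewrite psum_tnth //; apply: eq_bigl => i; rewrite ltn_ord. Qed.

Lemma card_ord_lt k : k <= n -> #|[set i : 'I_n | i < k]| = k.
Proof.
move=> kn; rewrite -sum1dep_card -(big_ord_widen n (fun=> 1)) //.
by rewrite sum_nat_const card_ord muln1.
Qed.

Lemma psum_landau_vector k : k <= n ->
  psum (landau_vector n) k = 'C(n, 2) - 'C(n - k, 2).
Proof.
(* In additive form the induction step is Pascal's rule for ['C(n - k, 2)]. *)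
move=> kn; suff : psum (landau_vector n) k + 'C(n - k, 2) = 'C(n, 2) by lia.
elim: k kn => [|k IHk] kn; first by rewrite psum0 subn0.
rewrite psumS (entry_tnth _ (Ordinal kn)) tnth_mktuple /= -(IHk (ltnW kn)).
by rewrite -addnA -[n - k](@subnSK k n) // binS bin1; lia.
Qed.

Lemma dominated_landau a :
  dominated a (landau_vector n) <-> forall k, 1 <= k <= n -> landau_ineq a k.
Proof.
by split=> dom k kn; have := dom k kn; rewrite /landau_ineq psum_landau_vector;
  case/andP: kn.
Qed.

(** Each of the first [k] entries is [t + (a_i - t)]; for the others the truncated difference is 0.
    Used with [t] equal to [a_k], and with [t = j] at [k = a'_j]. *)
Lemma psum_threshold a k t : k <= n ->
  (forall i : 'I_n, i < k -> t <= tnth a i) ->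
  (forall i : 'I_n, k <= i -> tnth a i <= t) ->
  psum a k = k * t + \sum_(i < n) (tnth a i - t).
Proof.
move=> kn ge_t le_t; rewrite psum_tnth // [in RHS](bigID (fun i : 'I_n => i < k)) /=.
rewrite [X in _ + (_ + X)]big1 ?addn0 => [|i]; last first.
  by rewrite -leqNgt => /le_t; rewrite -subn_eq0 => /eqP.
rewrite -{2}(card_ord_lt kn) -sum_nat_const.
rewrite [X in X + _](eq_bigl (fun i : 'I_n => i < k)) => [|i]; last by rewrite inE.
by rewrite -big_split; apply: eq_bigr => i /ge_t /=; lia.
Qed.

Lemma psum_entry a k : sorted geq a -> 0 < k <= n ->
  psum a k = k * entry a k + \sum_(i < n) (tnth a i - entry a k).
Proof.
move=> a_sorted kn; apply: psum_threshold => [|i ik|i ik]; first lia.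
  by rewrite -entry_tnth entry_sorted //; lia.
by rewrite -entry_tnth entry_sorted //; lia.
Qed.

(** With [t] the entry number [#|S|], each entry over [S] is at most [t + (a_i - t)], and the
    differences outside [S] only enlarge the right-hand side. *)
Lemma leq_sum_psum a (S : {set 'I_n}) : sorted geq a ->
  \sum_(i in S) tnth a i <= psum a #|S|.
Proof.
move=> a_sorted; have [S0|S_gt0] := posnP #|S|.
  by rewrite (cards0_eq S0) big_set0.
rewrite psum_entry ?S_gt0 //=; last by rewrite -[leqRHS]card_ord max_card.
set t := entry a _; rewrite -sum_nat_const.
rewrite [X in _ + X](bigID (mem S)) /= addnA -big_split /=.
apply: leq_trans (leq_addr _ _); apply: leq_sum => i _; lia.
Qed.

(** * The conjugate sequence *)

Lemma conjugate_tailE a j : conjugate_tail a j = \sum_(i < n) (tnth a i - j).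
Proof.
rewrite /conjugate_tail; set M := \max_(l < n) tnth a l.
under eq_bigr => i _ do rewrite /conjugate -sum1dep_card big_mkcond /=.
(* Double counting: [l] is counted once for each [i] with [j < i <= a_l]. *)
rewrite exchange_big /=; apply: eq_bigr => l _.
have le_M : tnth a l <= M by apply: leq_bigmax.
rewrite -big_mkcond /=.
rewrite -[LHS](big_nat_widen _ (tnth a l).+1 _ xpredT (fun=> 1)) ?ltnS //.
by rewrite sum_nat_const_nat muln1 subSS.
Qed.

(** Both sides say that the cell in row [k] and column [j] lies in the Young diagram of [a]: the
    indices with [a_i >= j] form an initial segment. *)
Lemma leq_conjugate a j k : sorted geq a -> 0 < j -> 0 < k ->
  (k <= conjugate a j) = (j <= entry a k).
Proof.
move=> a_sorted j0 k0; apply/idP/idP => [|le_j].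
  apply: contraTT; rewrite -!ltnNge => lt_j.
  (* There are [k.-1] indices below [k.-1] only if [k.-1 <= n]; otherwise [a'_j <= n] suffices. *)
  have [n_lt|le_n] := ltnP n k.-1.
    have : conjugate a j <= n by rewrite -[leqRHS]card_ord max_card.
    lia.
  rewrite -(prednK k0) ltnS -[leqRHS](card_ord_lt le_n).
  apply/subset_leq_card/subsetP => i; rewrite !inE -entry_tnth => le_ji.
  rewrite ltnNge; apply/negP => ki.
  have := entry_sorted a_sorted (_ : 0 < k <= i.+1); lia.
have kn : k <= n.
  rewrite leqNgt; apply/negP => nk; move: le_j.
  by rewrite /entry nth_default ?size_tuple; lia.
rewrite -[leqLHS](card_ord_lt kn).
apply/subset_leq_card/subsetP => i; rewrite !inE -entry_tnth => ik.
by apply: leq_trans le_j (entry_sorted a_sorted _).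
Qed.

(** The first [a'_j] entries are exactly those that reach [j], so [j] is a threshold there. This
    identifies the left-hand side of (6) with a partial sum. *)
Lemma psum_conjugate a j : sorted geq a -> 0 < j ->
  psum a (conjugate a j) = j * conjugate a j + conjugate_tail a j.
Proof.
move=> a_sorted j0; rewrite conjugate_tailE mulnC.
apply: psum_threshold => [|i ik|i ki].
- by rewrite -[leqRHS]card_ord max_card.
- by rewrite -entry_tnth -leq_conjugate.
- by rewrite -entry_tnth ltnW // ltnNge -leq_conjugate // -ltnNge.
Qed.

(** No entry after a corner [k] reaches [a_k]. This lets (6) be applied at [j = a_k]. *)
Lemma conjugate_entry a k : sorted geq a -> 0 < k ->
  entry a k.+1 < entry a k -> conjugate a (entry a k) = k.
Proof.
move=> a_sorted k0 corner; have e0 : 0 < entry a k by lia.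
apply/eqP; rewrite eqn_leq [k <= _]leq_conjugate // leqnn andbT.
by rewrite leqNgt leq_conjugate // -ltnNge.
Qed.

(** * Landau's inequalities and score sequences *)

Lemma landau_of_crossings a :
  psum a n = 'C(n, 2) ->
  (forall k, 1 <= k <= n - 1 -> entry a k.+1 < n - k < entry a k ->
     landau_ineq a k) ->
  forall k, k <= n -> landau_ineq a k.
Proof.
move=> sum_a cross.
(* Truncated: for [k <= n], [exc k] is 0 exactly when the inequality holds at [k]. *)
pose exc k := psum a k - psum (landau_vector n) k.
pose P k := (k <= n) && [forall j : 'I_n.+1, exc j <= exc k].
have exP : exists k, P k.
  have [i _ maxi] := arg_maxnP (fun i : 'I_n.+1 => exc i) (isT : xpredT (@ord0 n)).
  by exists i; rewrite /P -ltnS ltn_ord; apply/forallP => j; apply: maxi.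
case: (ex_minnP exP) => k /andP[kn /forallP k_max] k_min.
have {}k_max j : j <= n -> exc j <= exc k.
  by move=> jn; have := k_max (inord j); rewrite inordK.
suff exc0 : exc k = 0.
  move=> j jn; have := k_max j jn; rewrite exc0 leqn0 subn_eq0.
  by rewrite psum_landau_vector.
apply/eqP; rewrite -leqn0 leqNgt; apply/negP => exc_gt0.
have k0 : 0 < k by rewrite lt0n; apply: contraTneq exc_gt0 => ->; rewrite /exc psum0.
have k_lt : k < n.
  rewrite ltn_neqAle kn andbT; apply: contraTneq exc_gt0 => ->.
  by rewrite /exc sum_a psum_landau_vector // subnn subn0 subnn.
have landau_entry i : i < n -> entry (landau_vector n) i.+1 = n - i.+1.
  by move=> lt_in; rewrite (entry_tnth _ (Ordinal lt_in)) tnth_mktuple.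
(* As [exc k > 0], maximality against [k.+1] gives [a_(k+1) < n - k], and minimality of [k] gives
   [a_k > n - k]; the hypothesis at this crossing then forces [exc k = 0]. *)
have := k_max k.+1 k_lt; rewrite /exc !psumS landau_entry // => le_next.
have lt_prev : exc k.-1 < exc k.
  rewrite ltnNge; apply/negP => ge_prev; have := k_min k.-1; rewrite /P.
  suff -> : [forall j : 'I_n.+1, exc j <= exc k.-1] by lia.
  apply/forallP => j; apply: leq_trans ge_prev; apply: k_max.
  by rewrite -ltnS.
move: lt_prev exc_gt0 le_next; rewrite /exc.
case: k k0 {k_max k_min} kn k_lt => // k _ kn k_lt.
rewrite /= (psumS _ k) (psumS (landau_vector n) k) landau_entry //.
have := cross k.+1; rewrite /landau_ineq -psum_landau_vector // !psumS landau_entry //.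
by move=> /(_ ltac:(lia)) crossk; lia.
Qed.

(** The vertices outside the first [k] have outdegrees of sum at least ['C(n - k, 2)]; the rest of
    the total bounds the partial sum. *)
Lemma score_sequence_dominated a :
  score_sequence a -> dominated a (landau_vector n).
Proof.
case=> e [e_tour deg_e] k /andP[_ kn].
have sum_a : \sum_(i < n) tnth a i = 'C(n, 2).
  by rewrite (eq_bigr _ (fun i _ => deg_e i)) sum_outdeg // card_ord.
rewrite psum_landau_vector // psum_tnth //.
have := leq_sum_outdeg (~: [set i : 'I_n | i < k]) e_tour.
rewrite cardsCs setCK card_ord card_ord_lt // -sum_a.
rewrite [X in _ -> _ <= X - _](bigID (fun i : 'I_n => i < k)) /=.
under eq_bigl => i do rewrite !inE.
under eq_bigr => i _ do rewrite -deg_e.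
lia.
Qed.

(** The lower bound over [S] is the upper bound over its complement, whose sum is at most the
    partial sum at [n - #|S|]. *)
Lemma landau_score_sequence a :
  sorted geq a -> \sum_(i < n) tnth a i = 'C(n, 2) ->
  (forall k, k <= n -> landau_ineq a k) -> score_sequence a.
Proof.
move=> a_sorted sum_a landau_a; apply: landau_tournament; last by rewrite card_ord.
move=> S; have card_SC : #|~: S| = n - #|S| by rewrite cardsCs setCK card_ord.
have S_le : #|S| <= n by rewrite -[leqRHS]card_ord max_card.
have := landau_a #|~: S|; rewrite card_SC leq_subr /landau_ineq subKn // => /(_ isT).
have := leq_sum_psum (~: S) a_sorted; rewrite card_SC -sum_a.
rewrite [\sum_(i < n) _](bigID (mem S)) /=.
under [\sum_(i in ~: S) _]eq_bigl => i do rewrite inE.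
(* Ensures that the subtraction in the Landau inequality does not truncate. *)
have : 'C(#|S|, 2) <= 'C(n, 2) by rewrite leq_bin2l.
rewrite -sum_a [\sum_(i < n) _](bigID (mem S)) /=.
lia.
Qed.

End Vectors.

Theorem theorem3p14 (n : nat) (a : n.-tuple nat)
    (a_nonincreasing : sorted geq a)
    (a_sum : \sum_(i < n) tnth a i = 'C(n, 2)) :
  [<-> score_sequence a;
       dominated a (landau_vector n);
       forall k : nat, 1 <= k <= n -> landau_ineq a k;
       forall k : nat, k \in corners a -> landau_ineq a k;
       forall k : nat, 1 <= k <= n - 1 ->
         entry a k.+1 < n - k < entry a k -> landau_ineq a k;
       forall j : nat, j \in conjugate_corners a ->
         j * conjugate a j + conjugate_tail a j
           <= 'C(n, 2) - 'C(n - conjugate a j, 2)].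
Proof.
have psum_n : psum a n = 'C(n, 2) by rewrite psum_all.
tfae.
- exact: score_sequence_dominated.
- by move/dominated_landau.
- by move=> landau_a k /andP[kn _]; apply: landau_a.
- by move=> landau_a k kn ak; apply: landau_a; rewrite inE; lia.
(* (5) => (6): the inequality at [j] is Landau's at [k = a'_j]. *)
- move=> /(landau_of_crossings psum_n) landau_a j /andP[j0 _].
  by rewrite -psum_conjugate //; apply: landau_a; rewrite -[leqRHS]card_ord max_card.
(* (6) => (1): only crossings matter; a crossing [k] is a corner, so [j = a_k] has [a'_j = k]. *)
- move=> landau_conj; apply: landau_score_sequence => //.
  apply: landau_of_crossings => // k kn ak.
  have k0 : 0 < k by lia.
  have corner : entry a k.+1 < entry a k by lia.
  have e0 : 0 < entry a k by lia.
  have conj_k := conjugate_entry a_nonincreasing k0 corner.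
  (* This [j] is a corner of the conjugate: [a_k < j + 1] gives [a'_(j+1) < k]. *)
  rewrite /landau_ineq -conj_k psum_conjugate //; apply: landau_conj.
  by rewrite inE e0 conj_k ltnNge leq_conjugate // ltnn.
Qed.
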